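(* For transition kernels $P,Q$ on the same finite labelled states and actions and with the same discount factor $\gamma\in(0,1)$, $$P\equiv_{\mathrm{tr}}Q\ \Longrightarrow\ P\equiv_{\mathrm{sa}}Q\ \Longrightarrow\ P\equiv_{\mathrm{s}}Q,$$ and neither implication can be reversed: there exist states, actions, a discount factor, and transition kernels $P,Q$ with $P\equiv_{\mathrm{sa}}Q$ but $P\not\equiv_{\mathrm{tr}}Q$, and there exist states, actions, a discount factor, and transition kernels $P,Q$ with $P\equiv_{\mathrm{s}}Q$ but $P\not\equiv_{\mathrm{sa}}Q$.
   Context: $S=\{1,\dots,n\}$ is a finite set of states; each state $s$ has a finite nonempty action set $A(s)$; $\gamma\in(0,1)$ is fixed. A transition kernel $P$ assigns to each $s\in S$, $a\in A(s)$ a row vector $P_{s,a}=P(\cdot\mid s,a)\in\mathbb R^{1\times n}$ with nonnegative entries summing to $1$. A state--action reward is a family of real numbers $r(s,a)$, $s\in S$, $a\in A(s)$. The optimal value $V_{P,r}^*\in\mathbb R^n$ is the unique vector with $V_{P,r}^*(s)=\max_{a\in A(s)}\{r(s,a)+\gamma P_{s,a}V_{P,r}^*\}$ for all $s$, and $\operatorname{Opt}_{P,r}(s)=\arg\max_{a\in A(s)}\{r(s,a)+\gamma P_{s,a}V_{P,r}^*\}\subseteq A(s)$. A state reward $r:S\to\mathbb R$ is identified with the state--action reward $(s,a)\mapsto r(s)$. A transition-dependent reward is a family of real numbers $r(s,a,x)$, $s,x\in S$, $a\in A(s)$ ($x$ being the next state). Under a kernel $P$ it induces the state--action reward $\bar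 r_P(s,a)=\sum_{x\in S}P(x\mid s,a)r(s,a,x)$, and $\operatorname{Opt}_{P,r}$ means $\operatorname{Opt}_{P,\bar r_P}$. $P\equiv_{\mathrm{s}}Q$ (respectively $P\equiv_{\mathrm{sa}}Q$, $P\equiv_{\mathrm{tr}}Q$) means that $\operatorname{Opt}_{P,r}(s)=\operatorname{Opt}_{Q,r}(s)$ for every $s\in S$ and every state reward (respectively state--action reward, transition-dependent reward) $r$. *)

(* Defs.v *)
From HB Require Import structures.
From mathcomp Require Import all_boot all_order all_algebra.
From mathcomp Require Import boolp classical_sets reals.

Set Implicit Arguments.
Unset Strict Implicit.
Unset Printing Implicit Defensive.

Import Order.TTheory GRing.Theory Num.Theory.
Local Open Scope ring_scope.

(* States are 'I_n; the action sets form a family A : 'I_n -> finType. *)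

Record kernel (R : realType) (n : nat) (A : 'I_n -> finType) := Kernel {
  prob :> forall s : 'I_n, A s -> 'rV[R]_n;
  prob_ge0 : forall (s : 'I_n) (a : A s) (x : 'I_n), 0 <= prob a 0 x;
  prob_sum1 : forall (s : 'I_n) (a : A s), \sum_(x < n) prob a 0 x = 1
}.
Arguments prob {R n A} _ s a.

Definition sreward (R : realType) (n : nat) := 'I_n -> R.

Definition sareward (R : realType) (n : nat) (A : 'I_n -> finType) :=
  forall s : 'I_n, A s -> R.

Definition trreward (R : realType) (n : nat) (A : 'I_n -> finType) :=
  forall s : 'I_n, A s -> 'I_n -> R.

Definition sa_of_s (R : realType) (n : nat) (A : 'I_n -> finType)
    (r : sreward R n) : sareward R A :=
  fun s _ => r s.

Definition sa_of_tr (R : realType) (n : nat) (A : 'I_n -> finType)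
    (P : kernel R A) (r : trreward R A) : sareward R A :=
  fun s a => \sum_(x < n) P s a 0 x * r s a x.

Definition action_value (R : realType) (n : nat) (A : 'I_n -> finType)
    (gamma : R) (P : kernel R A) (r : sareward R A) (V : 'cV[R]_n)
    (s : 'I_n) (a : A s) : R :=
  r s a + gamma * (P s a *m V) 0 0.

Definition is_max (R : realType) (T : Type) (F : T -> R) (m : R) : Prop :=
  (exists a : T, F a = m) /\ (forall a : T, F a <= m).

Definition bellman (R : realType) (n : nat) (A : 'I_n -> finType)
    (gamma : R) (P : kernel R A) (r : sareward R A) (V : 'cV[R]_n) : Prop :=
  forall s : 'I_n, is_max (action_value gamma P r V (s := s)) (V s 0).

(* The default 0 of xget is never used when 0 < gamma < 1 and all action sets
   are nonempty: see optimal_valueP and optimal_value_unique. *)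
Definition optimal_value (R : realType) (n : nat) (A : 'I_n -> finType)
    (gamma : R) (P : kernel R A) (r : sareward R A) : 'cV[R]_n :=
  xget 0 [set V : 'cV[R]_n | bellman gamma P r V]%classic.

Definition Opt (R : realType) (n : nat) (A : 'I_n -> finType)
    (gamma : R) (P : kernel R A) (r : sareward R A) (s : 'I_n) : {set A s} :=
  [set a : A s |
    [forall b : A s, action_value gamma P r (optimal_value gamma P r) b
                  <= action_value gamma P r (optimal_value gamma P r) a]].

Definition equiv_s (R : realType) (n : nat) (A : 'I_n -> finType)
    (gamma : R) (P Q : kernel R A) : Prop :=
  forall (r : sreward R n) (s : 'I_n),
    Opt gamma P (sa_of_s r) s = Opt gamma Q (sa_of_s r) s.

Definition equiv_sa (R : realType) (n : nat) (A : 'I_n -> finType)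
    (gamma : R) (P Q : kernel R A) : Prop :=
  forall (r : sareward R A) (s : 'I_n), Opt gamma P r s = Opt gamma Q r s.

Definition equiv_tr (R : realType) (n : nat) (A : 'I_n -> finType)
    (gamma : R) (P Q : kernel R A) : Prop :=
  forall (r : trreward R A) (s : 'I_n),
    Opt gamma P (sa_of_tr P r) s = Opt gamma Q (sa_of_tr Q r) s.

Lemma exists_is_max (R : realType) (T : finType) (F : T -> R) :
  (0 < #|T|)%N -> exists m, is_max F m.
Proof.
case/card_gt0P=> a0 _; case: (arg_maxP F (isT : predT a0)) => a _ Ha.
by exists (F a); split; [exists a|move=> b; exact: Ha].
Qed.

Lemma action_value_shift (R : realType) (n : nat) (A : 'I_n -> finType)
    (gamma : R) (P : kernel R A) (r : sareward R A) (V W : 'cV[R]_n) (c : R)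
    (s : 'I_n) (a : A s) :
  0 <= gamma -> (forall x, V x 0 <= W x 0 + c) ->
  action_value gamma P r V a <= action_value gamma P r W a + gamma * c.
Proof.
move=> g0 VW; rewrite /action_value -addrA lerD2l -mulrDr ler_wpM2l// !mxE.
rewrite -[X in _ + X]mul1r -(prob_sum1 P a) mulr_suml -big_split/=.
by apply: ler_sum => x _; rewrite -mulrDr ler_wpM2l// prob_ge0.
Qed.

Lemma bellman_le (R : realType) (n : nat) (A : 'I_n -> finType)
    (gamma : R) (P : kernel R A) (r : sareward R A) (V W : 'cV[R]_n) :
  0 < gamma < 1 ->
  (forall s, exists a : A s, V s 0 <= action_value gamma P r V a) ->
  (forall s (a : A s), action_value gamma P r W a <= W s 0) ->
  forall s, V s 0 <= W s 0.
Proof.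
move=> /andP[g0 g1] HV HW s0.
case: (arg_maxP (fun s => V s 0 - W s 0) (isT : predT s0)) => s _ Hs.
set c := V s 0 - W s 0 in Hs.
have VW x : V x 0 <= W x 0 + c by rewrite -lerBlDl; exact: Hs.
have [a Ha] := HV s.
have := le_trans Ha (action_value_shift P r a (ltW g0) VW).
move/le_trans/(_ (lerD (HW s a) (lexx _))); rewrite -lerBlDl -/c => cgc.
have c0 : c <= 0.
  rewrite leNgt; apply/negP => c0.
  by move: cgc; rewrite -{1}[c]mul1r ler_pM2r// leNgt g1.
by rewrite -subr_le0 (le_trans (Hs s0 isT)).
Qed.

Lemma bellman_unique (R : realType) (n : nat) (A : 'I_n -> finType)
    (gamma : R) (P : kernel R A) (r : sareward R A) (V W : 'cV[R]_n) :
  0 < gamma < 1 -> bellman gamma P r V -> bellman gamma P r W -> V = W.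
Proof.
move=> g01 BV BW.
have sub U : bellman gamma P r U ->
    forall s, exists a : A s, U s 0 <= action_value gamma P r U a.
  by move=> BU s; have [[a <-] _] := BU s; exists a.
apply/matrixP => s j; rewrite (ord1 j); apply/eqP; rewrite eq_le.
apply/andP; split; apply: bellman_le (g01) _ _ s; try exact: sub.
- by move=> s; exact: (BW s).2.
- by move=> s; exact: (BV s).2.
Qed.

(* The solution is built as the pointwise supremum of all subsolutions. *)
Lemma bellman_exists (R : realType) (n : nat) (A : 'I_n -> finType)
    (gamma : R) (P : kernel R A) (r : sareward R A) :
  0 < gamma < 1 -> (forall s, (0 < #|A s|)%N) ->
  exists V : 'cV[R]_n, bellman gamma P r V.
Proof.
move=> g01 hA; have /andP[g0 g1] := g01.
have gp : 0 < 1 - gamma by rewrite subr_gt0.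
have /choice[T TP] (V : 'cV[R]_n) :
    exists W : 'cV[R]_n, forall s,
      is_max (action_value gamma P r V (s := s)) (W s 0).
  have /choice[f Hf] : forall s, exists m,
      is_max (action_value gamma P r V (s := s)) m.
    by move=> s; exact: exists_is_max.
  by exists (\col_s f s) => s; rewrite mxE.
have Tmono (V W : 'cV[R]_n) : (forall x, V x 0 <= W x 0) -> forall s, T V s 0 <= T W s 0.
  move=> VW s; have [[a <-] _] := TP V s.
  apply: le_trans ((TP W s).2 a); rewrite -[leRHS]addr0 -(mulr0 gamma).
  by apply: action_value_shift (ltW g0) _ => x; rewrite addr0.
pose K := \sum_s \sum_(a : A s) `|r s a|.
have rK s (a : A s) : `|r s a| <= K.
  rewrite /K (bigD1 s)//= (bigD1 a)//= -addrA lerDl addr_ge0//.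
  - by apply: sumr_ge0.
  - by apply: sumr_ge0 => ? _; apply: sumr_ge0.
pose M := K / (1 - gamma).
have MK : M = K + gamma * M.
  by apply/eqP; rewrite -subr_eq -{1}[M]mul1r -mulrBl mulrC divfK// gt_eqF.
have cst (c : R) s (a : A s) :
    action_value gamma P r (const_mx c) a = r s a + gamma * c.
  rewrite /action_value mxE; congr (_ + _ * _).
  under eq_bigr do rewrite mxE.
  by rewrite -mulr_suml prob_sum1 mul1r.
pose F := [set V : 'cV[R]_n | forall s, V s 0 <= T V s 0]%classic.
have FM (V : 'cV[R]_n) s : F V -> V s 0 <= M.
  move=> FV; have -> : M = (const_mx M : 'cV[R]_n) s 0 by rewrite mxE.
  apply: (@bellman_le _ _ _ gamma P r _ _ g01) => {}s => [|a].
    by have [[a Ha] _] := TP V s; exists a; rewrite Ha; exact: FV.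
  by rewrite cst mxE [leRHS]MK lerD2r (le_trans (ler_norm _)).
have F0 : F (const_mx (- M)).
  move=> s; have [[a <-] _] := TP (const_mx (- M)) s.
  rewrite cst mxE mulrN [in leLHS]MK opprD lerD2r lerNl.
  by rewrite (le_trans _ (rK s a))// -normrN ler_norm.
pose E s := [set V s 0 | V in F]%classic.
have supE s : has_sup (E s).
  split; first by exists (- M), (const_mx (- M)) => //; rewrite mxE.
  by exists M => _ [V FV <-]; exact: FM.
pose W : 'cV[R]_n := \col_s sup (E s).
have FW (V : 'cV[R]_n) s : F V -> V s 0 <= W s 0.
  by move=> FV; rewrite mxE; apply: ub_le_sup; [exact: (supE s).2|exists V].
have WT s : W s 0 <= T W s 0.
  rewrite mxE; apply: ge_sup; first exact: (supE s).1.
  move=> _ [V FV <-]; apply: le_trans (FV s) _.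
  by apply: Tmono => x; exact: FW.
have TW s : T W s 0 <= W s 0 by apply: FW => x; exact: Tmono.
exists W => s; have -> : W s 0 = T W s 0 by apply: le_anti; rewrite WT TW.
exact: TP.
Qed.

Lemma optimal_valueP (R : realType) (n : nat) (A : 'I_n -> finType)
    (gamma : R) (P : kernel R A) (r : sareward R A) :
  0 < gamma < 1 -> (forall s, (0 < #|A s|)%N) ->
  bellman gamma P r (optimal_value gamma P r).
Proof.
move=> g01 hA; have [V BV] := bellman_exists P r g01 hA.
exact: (@xgetI _ 0 [set V | bellman gamma P r V]%classic V BV).
Qed.

Lemma optimal_value_unique (R : realType) (n : nat) (A : 'I_n -> finType)
    (gamma : R) (P : kernel R A) (r : sareward R A) (V : 'cV[R]_n) :
  0 < gamma < 1 -> (forall s, (0 < #|A s|)%N) ->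
  bellman gamma P r V -> optimal_value gamma P r = V.
Proof.
move=> g01 hA BV.
exact: bellman_unique g01 (optimal_valueP P r g01 hA) BV.
Qed.

(* Main.v *)
(* A kernel that ignores the action makes [Opt] the argmax of the one-step
   reward, for every state-action reward; but transition-dependent rewards
   still see where it goes.  A kernel that ignores the current state makes
   V(s) - r(s) independent of s for a state reward r, so [Opt] at every state is
   the argmax of a |-> P_a r.  On two states, with p_a the probability of moving
   to state 0, this argmax only depends on the ordering of the p_a, whereas
   state-action rewards also detect the size of the gaps p_a - p_b. *)
Require Import Defs.
From mathcomp Require Import all_boot all_order all_algebra.
From mathcomp Require Import boolp classical_sets reals.
From mathcomp Require Import lra.

Import Order.TTheory GRing.Theory Num.Theory.
Local Open Scope ring_scope.

(** Rows of a kernel sum to 1, so averaging over the next state changes nothing here. State-action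
    rewards thus embed into transition-dependent ones in the same way for every kernel. *)
Lemma sa_of_tr_const (R : realType) (n : nat) (A : 'I_n -> finType)
    (P : kernel R A) (r : sareward R A) :
  sa_of_tr P (fun s a _ => r s a) = r.
Proof.
apply: functional_extensionality_dep => s.
apply: functional_extensionality_dep => a.
by rewrite /sa_of_tr -mulr_suml prob_sum1 mul1r.
Qed.

Lemma equiv_tr_sa (R : realType) (n : nat) (A : 'I_n -> finType) (gamma : R)
    (P Q : kernel R A) : equiv_tr gamma P Q -> equiv_sa gamma P Q.
Proof.
by move=> PQ r s; have := PQ (fun s a _ => r s a) s; rewrite !sa_of_tr_const.
Qed.

Lemma is_max_unique {R : realType} {T : Type} {F : T -> R} {m m' : R} :
  is_max F m -> is_max F m' -> m = m'.
Proof.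
move=> [[a <-] mub] [[b <-] m'ub].
by apply: le_anti; rewrite m'ub mub.
Qed.

(** Whatever the optimal value is, the continuation term is common to all actions at [s] and
    cancels. *)
Lemma Opt_action_free (R : realType) (n : nat) (A : 'I_n -> finType) (gamma : R)
    (P : kernel R A) (r : sareward R A) (s : 'I_n) :
  (forall a b : A s, P s a = P s b) ->
  Opt gamma P r s = [set a | [forall b, r s b <= r s a]].
Proof.
move=> Pconst; apply/setP => a; rewrite !inE; apply: eq_forallb => b.
by rewrite /action_value (Pconst a b) lerD2r.
Qed.

Lemma prob_mulmx_const (R : realType) (n : nat) (A : 'I_n -> finType)
    (P : kernel R A) (s : 'I_n) (a : A s) (c : R) :
  (P s a *m (const_mx c : 'cV_n)) 0 0 = c.
Proof.
by rewrite mxE; under eq_bigr do rewrite mxE; rewrite -mulr_suml prob_sum1 mul1r.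
Qed.

Lemma Opt_state_free (R : realType) (n : nat) (T : finType) (gamma : R)
    (P : kernel R (fun _ : 'I_n => T)) (p : T -> 'rV[R]_n) (r : sreward R n)
    (s : 'I_n) :
  0 < gamma < 1 -> (0 < #|T|)%N -> (forall s a, P s a = p a) ->
  Opt gamma P (sa_of_s r) s =
  [set a | [forall b, (p b *m \col_x r x) 0 0 <= (p a *m \col_x r x) 0 0]].
Proof.
move=> g01 T0 Pp; have /andP[g0 _] := g01.
have := optimal_valueP P (sa_of_s r) g01 (fun _ => T0).
rewrite /Opt; set V := optimal_value _ _ _ => BV.
(* The maximised family does not mention [x], so uniqueness of the maximum makes [V x 0 - r x] a
   constant. *)
have Vr x : is_max (fun a => gamma * (p a *m V) 0 0) (V x 0 - r x).
  have [[a Ea] ub] := BV x; split.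
    by exists a; rewrite -Ea /action_value /sa_of_s Pp addrC addKr.
  by move=> b; rewrite lerBrDl -(Pp x); exact: ub.
have VE : V = const_mx (V s 0 - r s) + \col_x r x.
  apply/matrixP => x j; rewrite (ord1 j) !mxE.
  by rewrite (is_max_unique (Vr s) (Vr x)) subrK.
apply/setP => a; rewrite !inE; apply: eq_forallb => b.
(* After dividing by [gamma], the constant part of [V] adds the same amount for both actions. *)
rewrite /action_value lerD2l ler_pM2l// VE !mulmxDr.
by rewrite [leLHS]mxE [leRHS]mxE !prob_mulmx_const lerD2l !Pp.
Qed.

Section TwoStates.
Context {R : realType}.

Definition two_row (p : R) : 'rV[R]_2 :=
  \row_x (if x == 0 then p else 1 - p).

Lemma two_row_ge0 (p : R) (x : 'I_2) : 0 <= p <= 1 -> 0 <= two_row p 0 x.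
Proof. by move=> /andP[p0 p1]; rewrite mxE; case: ifP; rewrite ?subr_ge0. Qed.

Lemma two_row_sum1 (p : R) : \sum_(x < 2) two_row p 0 x = 1.
Proof. by rewrite !big_ord_recl big_ord0 !mxE /= addr0 subrKC. Qed.

Lemma two_row_mul (p : R) (V : 'cV[R]_2) :
  (two_row p *m V) 0 0 = p * V 0 0 + (1 - p) * V 1 0.
Proof.
rewrite mxE !big_ord_recl big_ord0 !mxE /= addr0.
by congr (_ + _ * V _ _); apply: val_inj.
Qed.

Definition two_state_kernel (p : bool -> R) (hp : forall a, 0 <= p a <= 1) :
    kernel R (fun _ : 'I_2 => bool) :=
  @Kernel R 2 (fun=> bool) (fun=> two_row \o p)
    (fun _ a x => two_row_ge0 (p a) x (hp a)) (fun _ a => two_row_sum1 (p a)).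

Lemma bool_gt0 : (0 < #|{: bool}|)%N.
Proof. by rewrite card_bool. Qed.

Lemma half01 : 0 < (2^-1 : R) < 1.
Proof. by apply/andP; split; lra. Qed.

Lemma sa_not_tr :
  exists (P Q : kernel R (fun _ : 'I_2 => bool)),
    equiv_sa 2^-1 P Q /\ ~ equiv_tr 2^-1 P Q.
Proof.
have h1 : 0 <= (1 : R) <= 1 by rewrite ler01 lexx.
have h0 : 0 <= (0 : R) <= 1 by rewrite ler01 lexx.
exists (two_state_kernel (fun=> 1) (fun=> h1)), (two_state_kernel (fun=> 0) (fun=> h0)).
split=> [r s|PQ]; first by rewrite !Opt_action_free.
(* Only action [true] landing in state 0 is paid. The first kernel always lands there, so [true] is
   strictly better; the second never does, so the actions tie. *)
pose r : trreward R (fun _ : 'I_2 => bool) :=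
  fun _ a x => if a && (x == 0) then 1 else 0.
have : false \in Opt 2^-1 (two_state_kernel (fun=> 0) (fun=> h0))
                    (sa_of_tr (two_state_kernel (fun=> 0) (fun=> h0)) r) 0.
  rewrite Opt_action_free// inE; apply/forallP => b.
  rewrite /sa_of_tr !big_ord_recl !big_ord0 !mxE /r /= andbF.
  by case: b => /=; lra.
rewrite -PQ Opt_action_free// inE => /forallP/(_ true).
by rewrite /sa_of_tr !big_ord_recl !big_ord0 !mxE /r /=; lra.
Qed.

(** The expected rewards of [true] and [false] differ by [(p true - p false) * (r 0 - r 1)], and the
    first factor is positive. *)
Lemma Opt_two_state (gamma : R) (p : bool -> R) (hp : forall a, 0 <= p a <= 1)
    (r : sreward R 2) (s : 'I_2) : 0 < gamma < 1 -> p false < p true ->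
  Opt gamma (two_state_kernel p hp) (sa_of_s r) s =
  [set a : bool | if a then r 1 <= r 0 else r 0 <= r 1].
Proof.
move=> g01 pft; rewrite (@Opt_state_free _ _ _ _ _ (two_row \o p))//; last first.
  exact: bool_gt0.
apply/setP => a; rewrite !inE; apply/forallP/idP => [/(_ (~~ a))|ra b].
  rewrite /= !two_row_mul !mxE; case: a => /= H.
    have : 0 <= (p true - p false) * (r 0 - r 1) by lra.
    by rewrite pmulr_rge0 ?subr_gt0// subr_ge0.
  have : 0 <= (p true - p false) * (r 1 - r 0) by lra.
  by rewrite pmulr_rge0 ?subr_gt0// subr_ge0.
rewrite /= !two_row_mul !mxE.
by case: a b ra => [] [] /= ra; nra.
Qed.

(** Reduces checking an explicit value, with [true] optimal in both states, to linear arithmetic. *)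
Lemma bellman_two_state_true (gamma : R) (p : bool -> R)
    (hp : forall a, 0 <= p a <= 1)
    (r : sareward R (fun _ : 'I_2 => bool)) (V : 'cV[R]_2) :
  (forall s, r s true + gamma * (p true * V 0 0 + (1 - p true) * V 1 0) = V s 0
     /\ r s false + gamma * (p false * V 0 0 + (1 - p false) * V 1 0) <= V s 0) ->
  bellman gamma (two_state_kernel p hp) r V.
Proof.
move=> H s; have [Ht Hf] := H s; split.
  by exists true; rewrite /action_value /= two_row_mul.
by case; rewrite /action_value /= two_row_mul ?Ht.
Qed.

Lemma s_not_sa :
  exists (P Q : kernel R (fun _ : 'I_2 => bool)),
    equiv_s 2^-1 P Q /\ ~ equiv_sa 2^-1 P Q.
Proof.
(* Both [p] and [q] put [true] above [false], but with gaps 1 and 1/2. *)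
pose p (a : bool) : R := if a then 1 else 0.
pose q (a : bool) : R := if a then 1 else 2^-1.
have hp a : 0 <= p a <= 1 by case: a => /=; apply/andP; split; lra.
have hq a : 0 <= q a <= 1 by case: a => /=; apply/andP; split; lra.
exists (two_state_kernel p hp), (two_state_kernel q hq); split=> [r s|PQ].
  by rewrite !Opt_two_state ?half01//= /p /q; lra.
(* [r] makes [V] optimal for both kernels; at state 1 the action [false]
   ties with [true] under [q] but is strictly worse under [p]. *)
pose r : sareward R (fun _ : 'I_2 => bool) :=
  fun s a => if s == 0 then 1 else if a then 0 else 4^-1.
(* Action [true] surely leads to state 0 under both kernels, so the entries solve v0 = 1 + v0/2 and
   v1 = v0/2. As v0 - v1 = 1, choosing [false] at state 1 costs 1/4 in discounted continuation under
   [q] and 1/2 under [p], against a bonus of [4^-1]. *)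
pose V : 'cV[R]_2 := \col_s (if s == 0 then 2 else 1).
have VP : optimal_value 2^-1 (two_state_kernel p hp) r = V.
  apply: optimal_value_unique half01 (fun=> bool_gt0) _.
  apply: bellman_two_state_true => s; rewrite !mxE /p /r /=.
  by case: (s == 0); split; lra.
have VQ : optimal_value 2^-1 (two_state_kernel q hq) r = V.
  apply: optimal_value_unique half01 (fun=> bool_gt0) _.
  apply: bellman_two_state_true => s; rewrite !mxE /q /r /=.
  by case: (s == 0); split; lra.
have : false \in Opt 2^-1 (two_state_kernel q hq) r 1.
  rewrite inE VQ; apply/forallP => b.
  rewrite /action_value /= !two_row_mul !mxE /q /r /=.
  by case: b; lra.
rewrite -PQ inE VP => /forallP/(_ true).
by rewrite /action_value /= !two_row_mul !mxE /p /r /=; lra.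
Qed.

End TwoStates.

Theorem corollary5p5 (R : realType) :
  (forall (n : nat) (A : 'I_n -> finType) (gamma : R) (P Q : kernel R A),
     (forall s : 'I_n, (0 < #|A s|)%N) -> 0 < gamma < 1 ->
     (equiv_tr gamma P Q -> equiv_sa gamma P Q) /\
     (equiv_sa gamma P Q -> equiv_s gamma P Q)) /\
  (exists (n : nat) (A : 'I_n -> finType) (gamma : R) (P Q : kernel R A),
     (forall s : 'I_n, (0 < #|A s|)%N) /\ 0 < gamma < 1 /\
     equiv_sa gamma P Q /\ ~ equiv_tr gamma P Q) /\
  (exists (n : nat) (A : 'I_n -> finType) (gamma : R) (P Q : kernel R A),
     (forall s : 'I_n, (0 < #|A s|)%N) /\ 0 < gamma < 1 /\
     equiv_s gamma P Q /\ ~ equiv_sa gamma P Q).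
Proof.
split=> [n A gamma P Q _ _|].
  by split; [exact: equiv_tr_sa|move=> PQ r s; exact: PQ].
split.
  have [P [Q PQ]] := @sa_not_tr R.
  exists 2, (fun=> bool), 2^-1, P, Q.
  by split=> [s|]; [exact: bool_gt0|split; [exact: half01|]].
have [P [Q PQ]] := @s_not_sa R.
exists 2, (fun=> bool), 2^-1, P, Q.
by split=> [s|]; [exact: bool_gt0|split; [exact: half01|]].
Qed.
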